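(* Let $A$ be an operator on a Banach space $X$ that admits a $\mathcal B$-calculus. Then \[\sup_{\alpha>0}\alpha\int_{\mathbb R}\big|\langle(\alpha+i\beta+A)^{-2}x,x^*\rangle\big|\,d\beta<\infty\quad\text{for all }x\in X,\ x^*\in X^*.\]
   Context: $\mathbb C_+=\{z:\Re z>0\}$. $\mathcal B$ is the Banach algebra of holomorphic $f$ on $\mathbb C_+$ with $\|f\|_{\mathcal B_0}:=\int_0^\infty\sup_{\beta\in\mathbb R}|f'(\alpha+i\beta)|\,d\alpha<\infty$, with norm $\|f\|_{\mathcal B}=\sup_{\mathbb C_+}|f|+\|f\|_{\mathcal B_0}$. For $z\in\mathbb C_+$, $r_z(\lambda)=(z+\lambda)^{-1}$ ($r_z\in\mathcal B$). An operator $A$ on $X$ admits a $\mathcal B$-calculus if $A$ is densely defined, $\sigma(A)\subset\overline{\mathbb C}_+$, and there is a bounded algebra homomorphism $\Phi:\mathcal B\to L(X)$ with $\Phi(r_z)=(z+A)^{-1}$ for all $z\in\mathbb C_+$. *)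

(* Defs.v *)
From HB Require Import structures.
From mathcomp Require Import all_boot all_order all_algebra.
From mathcomp Require Import all_classical all_reals all_analysis.
From mathcomp Require Import complex.
Set Implicit Arguments. Unset Strict Implicit. Unset Printing Implicit Defensive.
Import Order.TTheory GRing.Theory Num.Theory.
Import numFieldNormedType.Exports.
Local Open Scope classical_set_scope.
Local Open Scope ring_scope.

(* The complex field C = R[i], seen as a numFieldType (hence a normed
   module over itself, with its usual topology). *)
Definition Cplx (R : realType) : numFieldType := R[i].

(* Real-valued modulus / norm: in MathComp-Analysis the norm of a vector in a
   normed C-module is an element of C (a nonnegative real one); we take its
   real part to get the usual real-valued norm. *)
Definition nrm (R : realType) (V : normedModType (Cplx R)) (v : V) : R :=
  complex.Re (`|v| : Cplx R).

Definition Cplus (R : realType) : set (Cplx R) :=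
  [set z : Cplx R | 0 < complex.Re (z : R[i])].
Arguments Cplus R : clear implicits.

Definition cpt (R : realType) (a b : R) : Cplx R := Complex a b.

(* f is holomorphic on C_+ : complex differentiable at every point of C_+
   (derivable over the scalar field C, i.e. the difference quotient
   (f (z + h) - f z) / h converges as the complex number h -> 0). *)
Definition holo_rhp (R : realType) (f : Cplx R -> Cplx R) : Prop :=
  forall z, Cplus R z -> derivable f z 1.

Definition supnorm_rhp (R : realType) (f : Cplx R -> Cplx R) : \bar R :=
  ereal_sup [set (nrm (f z))%:E | z in Cplus R].

Definition normB0 (R : realType) (f : Cplx R -> Cplx R) : \bar R :=
  (\int[@lebesgue_measure R]_(a in [set a : R | (0 < a)%R])
     ereal_sup [set (nrm ('D_1 f (cpt a b) : Cplx R))%:E | b in [set: R]])%E.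

Definition inB (R : realType) (f : Cplx R -> Cplx R) : Prop :=
  [/\ holo_rhp f, (supnorm_rhp f < +oo)%E & (normB0 f < +oo)%E].

(* ||f||_B = sup |f| + ||f||_{B_0} (for f in B both are finite) *)
Definition normB (R : realType) (f : Cplx R -> Cplx R) : R :=
  fine (supnorm_rhp f) + fine (normB0 f).

Definition rz (R : realType) (z : Cplx R) : Cplx R -> Cplx R :=
  fun l => (z + l)^-1.

Definition bounded_op (R : realType) (X : normedModType (Cplx R)) (T : X -> X)
  : Prop :=
  (forall (a : Cplx R) (x y : X), T (a *: x + y) = a *: T x + T y) /\
  exists M : R, forall x, nrm (T x) <= M * nrm x.

(* An (unbounded) operator is given by its domain D and its action A on D.
   It is densely defined: D is a linear subspace, A is linear on D, and D is
   dense in X. *)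
Definition densely_defined (R : realType) (X : normedModType (Cplx R))
  (D : set X) (A : X -> X) : Prop :=
  [/\ D 0,
      (forall (a : Cplx R) x y, D x -> D y -> D (a *: x + y)),
      (forall (a : Cplx R) x y, D x -> D y -> A (a *: x + y) = a *: A x + A y)
    & closure D = [set: X]].

Definition is_inverse_zA (R : realType) (X : normedModType (Cplx R))
  (D : set X) (A : X -> X) (z : Cplx R) (Rz : X -> X) : Prop :=
  (forall x, D (Rz x) /\ z *: Rz x + A (Rz x) = x) /\
  (forall y, D y -> Rz (z *: y + A y) = y).

(* the resolvent (z + A)^{-1} x : the (unique, when z + A is invertible)
   u in D with z u + A u = x *)
Definition resolvent (R : realType) (X : normedModType (Cplx R))
  (D : set X) (A : X -> X) (z : Cplx R) : X -> X :=
  fun x => xget 0 [set u | D u /\ z *: u + A u = x].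

(* sigma(A) is contained in the closed right half plane: for every lambda
   with Re lambda < 0, i.e. lambda = -z with z in C_+, the operator
   lambda - A = -(z + A) has a bounded inverse. *)
Definition spectrum_in_closed_rhp (R : realType) (X : normedModType (Cplx R))
  (D : set X) (A : X -> X) : Prop :=
  forall z, Cplus R z -> exists Rz, bounded_op Rz /\ is_inverse_zA D A z Rz.

Definition bounded_alg_hom (R : realType) (X : normedModType (Cplx R))
  (Phi : (Cplx R -> Cplx R) -> X -> X) : Prop :=
  [/\ (forall f, inB f -> bounded_op (Phi f)),
      (forall (a : Cplx R) f g, inB f -> inB g ->
          Phi (fun l => a * f l + g l) = (fun x => a *: Phi f x + Phi g x)),
      (forall f g, inB f -> inB g ->
          Phi (fun l => f l * g l) = (fun x => Phi f (Phi g x)))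
    & exists M : R, forall f, inB f -> forall x,
          nrm (Phi f x) <= M * normB f * nrm x].

Definition admits_B_calculus (R : realType) (X : normedModType (Cplx R))
  (D : set X) (A : X -> X) : Prop :=
  [/\ densely_defined D A,
      spectrum_in_closed_rhp D A
    & exists Phi : (Cplx R -> Cplx R) -> X -> X,
        bounded_alg_hom Phi /\
        forall z, Cplus R z -> Phi (rz z) = resolvent D A z].

Definition dual_elt (R : realType) (X : normedModType (Cplx R))
  (xs : X -> Cplx R) : Prop :=
  (forall (a : Cplx R) (x y : X), xs (a *: x + y) = a * xs x + xs y) /\
  continuous xs.

(* Main.v *)
Require Import Defs.
From HB Require Import structures.
From mathcomp Require Import all_boot all_order all_algebra.
From mathcomp Require Import all_classical all_reals all_analysis.
From mathcomp Require Import measurable_realfun complex ring lra.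
Import Order.TTheory GRing.Theory Num.Theory.
Import numFieldNormedType.Exports.
Local Open Scope classical_set_scope.
Local Open Scope ring_scope.
Set Implicit Arguments.
Unset Strict Implicit.

(* Fix [a > 0] and sample the vertical line [Re z = a] at the points
   [z_j = a + i (t + j a)], [j < n].  If [|c_j| <= a^2], then
   [f = sum_j c_j r_(z_j)^2] satisfies [|f| <= 8] and
   [|f'(l)| <= 16 a / (a + Re l)^2] on the right half plane, so that its norm in
   B is at most 24, whatever [a], [t] and [n] are.  Choosing the phases of the
   [c_j] so that [c_j <(z_j + A)^-2 x, x*>] is nonnegative, the boundedness of
   the calculus bounds [a^2 sum_j |<(z_j + A)^-2 x, x*>|] uniformly in [a], [t]
   and [n]; integrating over [t] in an interval of length [a] turns these sums
   into the integral over the whole line. *)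

(** * A uniform bound for sums over an arithmetic progression, and monotonicity of the integral *)

Section real_estimates.
Variable R : realType.

(* A bounded increasing function whose increments dominate the terms of the
   sums in [grid_sum_le], which therefore telescope. *)
Definition squash (x : R) : R := x / (1 + `|x|).

Lemma squash_le1 (x : R) : `|squash x| <= 1.
Proof.
rewrite /squash normrM normfV [`|1 + _|]ger0_norm ?addr_ge0//.
by rewrite ler_pdivrMr ?mul1r ?lerDr// ltr_pwDl.
Qed.

(** When [x] and [x + h] have the same sign, the increment equals [h / ((1 + |x|) (1 + |x + h|))],
    and [h <= 1] keeps this denominator at most [4 (1 + x ^+ 2)]. *)
Lemma squash_increment (x h : R) : 0 < h -> h <= 1 ->
  h / (1 + x ^+ 2) <= 4 * (squash (x + h) - squash x).
Proof.
move=> h0 h1; rewrite /squash.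
have q0 : 0 < 1 + x ^+ 2 by have := sqr_ge0 x; lra.
rewrite ler_pdivrMr//.
have [x0|x0] := leP 0 x.
  rewrite !ger0_norm; [|lra..].
  have -> : 4 * ((x + h) / (1 + (x + h)) - x / (1 + x)) * (1 + x ^+ 2) =
            h * (4 * (1 + x ^+ 2) / ((1 + (x + h)) * (1 + x))).
    by field; apply/andP; split; apply: lt0r_neq0; lra.
  apply: ler_peMr; [exact: ltW|rewrite ler_pdivlMr ?mul1r]; last first.
    by rewrite mulr_gt0//; lra.
  have : h * (1 + x) <= 1 * (1 + x) by rewrite ler_wpM2r//; lra.
  by have := sqr_ge0 (x - 1); have := sqr_ge0 x; nra.
(* Across zero both denominators are at most 2, so the increment is at least [h / 2]. *)
have [xh0|xh0] := leP 0 (x + h).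
  rewrite (ltr0_norm x0) (ger0_norm xh0).
  have H1 : h / 2 * (1 + x ^+ 2)^-1 <= (x + h) / 2 + - x / 2.
    have : (1 + x ^+ 2)^-1 <= 1 by rewrite invf_le1//; nra.
    nra.
  have H2 : (x + h) / 2 <= (x + h) / (1 + (x + h)).
    by rewrite ler_wpM2l// lef_pV2 ?posrE; lra.
  have H3 : - x / 2 <= - x / (1 + - x).
    by rewrite ler_wpM2l; [|lra|]; rewrite ?lef_pV2 ?posrE; lra.
  rewrite -ler_pdivrMr//; rewrite mulNr in H3.
  by lra.
rewrite !ltr0_norm//.
have -> : 4 * ((x + h) / (1 + - (x + h)) - x / (1 + - x)) * (1 + x ^+ 2) =
          h * (4 * (1 + x ^+ 2) / ((1 - (x + h)) * (1 - x))).
  by field; apply/andP; split; apply: lt0r_neq0; lra.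
apply: ler_peMr; [exact: ltW|rewrite ler_pdivlMr ?mul1r]; last first.
  by rewrite mulr_gt0//; lra.
have : 0 <= h * (1 - x) by rewrite mulr_ge0//; lra.
by have := sqr_ge0 (x + 1); have := sqr_ge0 x; nra.
Qed.

(** This is a Riemann sum of [1 / (s ^+ 2 + v ^+ 2)], whose integral over the line is pi / s.
    Rescaling by [s] makes the mesh [a / s <= 1], as [squash_increment] requires. *)
Lemma grid_sum_le (s a u : R) (n : nat) : 0 < a -> a <= s ->
  \sum_(j < n) a / (s ^+ 2 + (u + j%:R * a) ^+ 2) <= 8 / s.
Proof.
move=> a0 as_; have s0 : 0 < s by lra.
pose x (j : nat) := (u + j%:R * a) / s.
have h0 : 0 < a / s by rewrite divr_gt0.
have h1 : a / s <= 1 by rewrite ler_pdivrMr ?mul1r.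
have xS j : x j.+1 = x j + a / s by rewrite /x -natr1; field; exact: lt0r_neq0.
have step j : a / (s ^+ 2 + (u + j%:R * a) ^+ 2) <=
    4 / s * (squash (x j.+1) - squash (x j)).
  have -> : a / (s ^+ 2 + (u + j%:R * a) ^+ 2) =
            s^-1 * (a / s / (1 + x j ^+ 2)).
    rewrite /x; field; rewrite lt0r_neq0//= lt0r_neq0//.
    by have := sqr_ge0 (u + j%:R * a); have := exprn_gt0 2 s0; lra.
  rewrite [leRHS]mulrAC [leRHS]mulrC ler_pM2l ?invr_gt0// xS.
  exact: squash_increment.
apply: le_trans (ler_sum _ (fun (j : 'I_n) _ => step j)) _.
rewrite -mulr_sumr -(big_mkord predT (fun j => squash (x j.+1) - squash (x j))).
rewrite telescope_sumr// (_ : 8 / s = 4 / s * 2); last by ring.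
rewrite ler_pM2l ?divr_gt0//.
(* Both end values of [squash] lie in [-1, 1], so the telescoped difference is at most 2. *)
have := squash_le1 (x n); have := squash_le1 (x 0%N); rewrite !ler_norml.
lra.
Qed.

(** The integral of a nonnegative function is a supremum over the simple functions below it, and
    enlarging the function only adds competitors. This serves for the supremum over a vertical line
    in [normB0]. *)
Lemma le_integralT_nonmeasurable d (T : measurableType d)
    (m : {measure set T -> \bar R}) (f g : T -> \bar R) :
  (forall x, 0 <= f x)%E -> (forall x, f x <= g x)%E ->
  (\int[m]_x f x <= \int[m]_x g x)%E.
Proof.
move=> f0 fg; have g0 x : (0 <= g x)%E := le_trans (f0 x) (fg x).
rewrite !ge0_integralTE//; apply: ge_ereal_sup => _ [h hf <-].
by apply: ereal_sup_ubound; exists h => // x; exact: le_trans (hf x) (fg x).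
Qed.

Lemma le_integral_nonmeasurable d (T : measurableType d)
    (m : {measure set T -> \bar R}) (D : set T) (f g : T -> \bar R) :
  (forall x, D x -> 0 <= f x)%E -> (forall x, D x -> f x <= g x)%E ->
  (\int[m]_(x in D) f x <= \int[m]_(x in D) g x)%E.
Proof.
move=> f0 fg; rewrite integral_mkcond [leRHS]integral_mkcond.
apply: le_integralT_nonmeasurable; first exact: erestrict_ge0.
by move=> x; exact: lee_restrict.
Qed.

End real_estimates.

(** * Translation invariance and cutting of Lebesgue integrals into cells *)

Section integration_on_grids.
Import HBNNSimple.
Variable R : realType.
Local Notation mu := (@lebesgue_measure R).
Lemma measurable_fun_shift (c : R) : measurable_fun setT
  (fun x : measurableTypeR R => x + c : measurableTypeR R).
Proof. by apply: measurable_funD. Qed.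

(** The image of Lebesgue measure under a translation gives half-open intervals their length, which
    determines it. *)
Lemma lebesgue_measure_shift (c : R) (A : set R) : measurable A ->
  mu ((fun x : R => x + c) @^-1` A) = mu A.
Proof.
have mphi := measurable_fun_shift c.
move=> mA; apply/esym.
apply: (@lebesgue_measure_unique R (pushforward mu
  (fun x : measurableTypeR R => x + c : measurableTypeR R))) => //.
move=> _ [[x y] _ <-] /=; rewrite /pushforward.
rewrite (_ : _ @^-1` _ = `]x - c, y - c]%classic).
  rewrite !lebesgue_measure_itv/= !lte_fin ltrD2r; case: ifP => // _.
  by rewrite -!EFinB; congr EFin; ring.
by apply/seteqP; split=> t /=; rewrite !in_itv/= => /andP[? ?]; apply/andP; lra.
Qed.

Lemma ge0_integral_shift (c : R) (D : set R) (f : R -> \bar R) :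
  measurable D -> measurable_fun D f -> (forall x, D x -> 0 <= f x)%E ->
  (\int[mu]_(x in D) f x =
   \int[mu]_(x in (fun x => (x + c)%R) @^-1` D) f (x + c)%R)%E.
Proof.
move=> mD mf f0.
have mphi := measurable_fun_shift c.
rewrite -(@ge0_integral_pushforward _ _ _ _ R _ mphi mu D f)//; last first.
  by move=> x /[!inE]; exact: f0.
apply: eq_measure_integral => A mA _.
by rewrite /= /pushforward -[LHS](lebesgue_measure_shift c).
Qed.

(** Induction on the number of cells: each new cell []c + n a, c + (n + 1) a]] is translated back
    onto []0, a]]. *)
Lemma ge0_integral_grid (a c : R) (n : nat) (f : R -> \bar R) :
  0 < a -> measurable_fun setT f -> (forall x, 0 <= f x)%E ->
  (\int[mu]_(x in `]c, (c + n%:R * a)%R]) f x =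
   \int[mu]_(t in `]0%R, a]) (\sum_(j < n) f (t + c + j%:R * a)%R))%E.
Proof.
move=> a0 mf f0.
have mfs u : measurable_fun setT (fun t : R => f (t + u)).
  by apply: (measurableT_comp mf); exact: measurable_fun_shift.
have mfs2 j : measurable_fun setT (fun t : R => f (t + c + j%:R * a)).
  rewrite (_ : (fun _ => _) = (fun t => f (t + (c + j%:R * a))))//.
  by apply/funext => t; rewrite addrA.
elim: n => [|n ih].
  rewrite mul0r addr0 set_itvoc0 integral_set0.
  by under eq_integral do rewrite big_ord0; rewrite integral0.
rewrite (@itv_bndbnd_setU _ _ _ (BRight (c + n%:R * a))); last 2 first.
- by rewrite bnd_simp lerDl mulr_ge0// ltW.
- by rewrite bnd_simp lerD2l ler_pM2r// ler_nat.
rewrite ge0_integral_setU//=; last 2 first.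
- exact: measurable_funTS.
- apply/disj_setPLR => t /=; rewrite !in_itv/= => /andP[_ tn].
  by apply/negP; rewrite ltNge tn.
under [RHS]eq_integral do rewrite big_ord_recr/=.
rewrite ge0_integralD//; last 3 first.
- by move=> t _; apply: sume_ge0.
- by apply: measurable_funTS; apply: emeasurable_sum => j; exact: mfs2.
- by apply: measurable_funTS; exact: mfs2.
rewrite ih; congr (_ + _)%E.
rewrite (@ge0_integral_shift (c + n%:R * a))//; last exact: measurable_funTS.
rewrite (_ : _ @^-1` _ = `]0, a]%classic).
  by apply: eq_integral => t _; rewrite addrA.
apply/seteqP; split=> t /=; rewrite !in_itv/= -natr1 => /andP[? ?];
  by apply/andP; lra.
Qed.

(* Only simple functions below [f] enter the integral, so [f] need not be
   measurable. *)
Lemma integral_le_grid (a K : R) (f : R -> R) :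
  0 < a -> (forall x, 0 <= f x) ->
  (forall t n, \sum_(j < n) f (t + j%:R * a) <= K) ->
  (\int[mu]_x (f x)%:E <= (K * a)%:E)%E.
Proof.
move=> a0 f0 fK.
rewrite ge0_integralTE; last by move=> x; rewrite lee_fin.
apply: ge_ereal_sup => _ [h hf <-].
have h0 x : (0 <= (h x)%:E)%E by rewrite lee_fin; exact: fun_ge0.
have mh : measurable_fun setT (EFin \o h) by exact/measurable_EFinP.
rewrite (_ : sintegral _ _ = \int[mu]_x (h x)%:E)%E; last first.
  by rewrite integral_nnsfun// patch_setT.
(* The windows []- n a, n a]] exhaust the line. Writing the right end as [- n a + 2 n a] presents
   each of them as [n.*2] cells of length [a], the form of [ge0_integral_grid]. *)
pose F n := (`]- (n%:R * a), - (n%:R * a) + n.*2%:R * a]%classic : set R).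
have FE n : F n = `]- (n%:R * a), n%:R * a]%classic.
  rewrite /F; have -> // : - (n%:R * a) + n.*2%:R * a = n%:R * a :> R.
  by rewrite -muln2 natrM; ring.
have FT : \bigcup_i F i = setT.
  apply/seteqP; split=> // x _.
  exists (Num.truncn (`|x| / a)).+1 => //.
  rewrite FE /= in_itv/=.
  have : `|x| / a < (Num.truncn (`|x| / a)).+1%:R by exact: truncnS_gt.
  by rewrite ltr_pdivrMr// ltr_norml => /andP[-> /ltW ->].
rewrite -FT.
have cF : (\int[mu]_(x in F i) (h x)%:E @[i --> \oo] -->
          \int[mu]_(x in \bigcup_i F i) (h x)%:E)%E.
  apply: ge0_nondecreasing_set_cvg_integral => //.
  - move=> m n mn; rewrite !FE; apply/subsetPset => x /=; rewrite !in_itv/=.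
    have : m%:R * a <= n%:R * a by rewrite ler_pM2r// ler_nat.
    by move=> ? /andP[? ?]; apply/andP; lra.
  - by move=> n; rewrite FE.
  - by move=> n; exact: measurable_funTS.
rewrite -(cvg_lim _ cF)//; apply: lime_le.
  by apply/cvg_ex; eexists; exact: cF.
apply: nearW => n.
rewrite /F ge0_integral_grid//.
(* On one cell the sum over the grid is at most [K]; integrating over a length [a] gives [K a]. *)
apply: (@le_trans _ _ (\int[mu]_(t in `]0%R, a]) (cst K%:E) t)%E).
  apply: le_integral_nonmeasurable.
    by move=> t _; apply: sume_ge0.
  move=> t _ /=; rewrite sumEFin lee_fin.
  apply: le_trans (fK (t - n%:R * a) n.*2).
  by apply: ler_sum => j _; rewrite -lee_fin; exact: hf.
by rewrite integral_cst//= lebesgue_measure_itv/= lte_fin a0 -EFinB subr0 EFinM.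
Qed.

Lemma continuous_inv_sqr (c x : R) : 0 < c -> 0 <= x ->
  {for x, continuous (fun a : R => (c + a) ^- 2)}.
Proof.
move=> c0 x0; apply: cvgV.
  by rewrite expf_neq0// lt0r_neq0// ltr_pwDl.
by apply: (@cvgM _ _ _ _ (fun a => c + a) (fun a => c + a)); apply: cvgD;
  [exact: cvg_cst|exact: cvg_id|exact: cvg_cst|exact: cvg_id].
Qed.

(** [- (c + a)^-1] is an antiderivative vanishing at infinity. The integrand is the weight that
    dominates [|f'|] in [inB_le]. *)
Lemma integral_inv_sqr (c : R) : 0 < c ->
  (\int[mu]_(a in [set a : R | (0 < a)%R]) ((c + a) ^- 2)%R%:E = (c^-1)%:E)%E.
Proof.
move=> c0.
have cne (x : R) : 0 <= x -> c + x != 0 by move=> ?; apply: lt0r_neq0; lra.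
have dF (x : R) : 0 <= x ->
    is_derive x 1 (fun a => - (c + a)^-1) ((c + x) ^- 2).
  move=> x0.
  have dV : is_derive x 1 (fun a : R => (c + a)^-1) (- (c + x) ^- 2 *: (0 + 1)).
    have dc : is_derive x 1 (fun a : R => c + a) (0 + 1) by apply: is_deriveD.
    apply: DeriveDef; first by apply: derivableV; [exact: cne|].
    by rewrite deriveV ?cne// (@derive_val _ _ _ _ _ _ _ dc).
  have := is_deriveN dV; rewrite add0r /GRing.scale/= mulr1 opprK.
  by apply.
rewrite (_ : [set a | _] = `]0, +oo[%classic); last first.
  by apply/seteqP; split=> t /=; rewrite in_itv/= andbT.
(* Adding the null endpoint 0 matches the interval of the fundamental theorem of calculus. *)
rewrite integral_itv_obnd_cbnd; last first.
  apply/measurable_EFinP; apply: open_continuous_measurable_fun => //.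
  move=> x /[!inE]/=; rewrite in_itv/= andbT => /ltW.
  exact: continuous_inv_sqr.
rewrite (@ge0_continuous_FTC2y R _ (fun a => - (c + a)^-1) 0 0).
- by rewrite addr0 -EFinB sub0r opprK.
- by move=> x x0; rewrite invr_ge0 sqr_ge0.
- apply: continuous_in_subspaceT => x /[!inE]/=; rewrite in_itv/= andbT.
  exact: continuous_inv_sqr.
- rewrite -oppr0; apply: cvgN; apply/gtr0_cvgV0.
    by near=> x; have : 0 < x by []; lra.
  exact: cvg_addrl.
- by move=> x x0; have [] := dF x (ltW x0).
- apply: cvg_at_right_filter.
  have [/derivable1_diffP/differentiable_continuous] := dF 0 (lexx 0).
  by move=> + _; apply.
- move=> x; rewrite in_itv/= andbT => x0; rewrite derive1E.
  by have [_ ->] := dF x (ltW x0).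
Unshelve. all: by end_near. Qed.
End integration_on_grids.

(** * Real-valued norm of a complex normed space *)

Section nrm.
Variables (R : realType) (V : normedModType (Cplx R)).

(** In [R[i]], [0 <= z] forces the imaginary part of [z] to be zero, so [nrm] loses nothing of the
    complex-valued norm. *)
Lemma nrmE (v : V) : `|v| = Complex (nrm v) 0 :> Cplx R.
Proof.
rewrite /nrm; have : 0 <= (`|v| : R[i]) by exact: normr_ge0.
by case: (`|v| : R[i]) => a b; rewrite lecE/= => /andP[/eqP -> _].
Qed.

Lemma nrm_ge0 (v : V) : 0 <= nrm v.
Proof.
have : 0 <= (`|v| : R[i]) by exact: normr_ge0.
by rewrite lecE => /andP[].
Qed.

Lemma nrm0 : nrm (0 : V) = 0.
Proof. by rewrite /nrm normr0. Qed.

Lemma ler_nrmD (v w : V) : nrm (v + w) <= nrm v + nrm w.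
Proof.
have : (`|v + w| : R[i]) <= `|v| + `|w| by exact: ler_normD.
by rewrite lecE => /andP[_]; rewrite raddfD.
Qed.

Lemma nrmZ (a : Cplx R) (v : V) : nrm (a *: v) = nrm a * nrm v.
Proof. by rewrite {1}/nrm normrZ !nrmE/= mul0r subr0. Qed.

Lemma ler_nrm_sum n (F : 'I_n -> V) :
  nrm (\sum_i F i) <= \sum_i nrm (F i).
Proof.
elim/big_ind2 : _ => [|x1 x2 y1 y2 h1 h2|//]; first by rewrite nrm0.
exact: le_trans (ler_nrmD _ _) (lerD h1 h2).
Qed.
End nrm.

(** * Modulus, phases, and derivatives of the resolvent functions *)

Section nrm_complex.
Variable R : realType.
Implicit Types z w : Cplx R.

Lemma nrmM z w : nrm (z * w) = nrm z * nrm w.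
Proof. exact: (@nrmZ R (Cplx R) z w). Qed.

Lemma nrmN z : nrm (- z) = nrm z.
Proof. by rewrite /nrm normrN. Qed.

Lemma nrmV z : nrm (z^-1) = (nrm z)^-1.
Proof.
have [->|z0] := eqVneq z 0; first by rewrite invr0 nrm0 invr0.
have zz : nrm z^-1 * nrm z = 1 by rewrite -nrmM mulVf// /nrm normr1.
have nz : nrm z != 0.
  by apply: contra_eq_neq zz => ->; rewrite mulr0 eq_sym oner_eq0.
by apply: (mulIf nz); rewrite zz mulVf.
Qed.

Lemma nrm_sqr (a b : R) : nrm (cpt a b) ^+ 2 = a ^+ 2 + b ^+ 2.
Proof.
by rewrite /nrm /cpt normc_def /= sqr_sqrtr// addr_ge0// sqr_ge0.
Qed.

Lemma Re_le_nrm z : complex.Re (z : R[i]) <= nrm z.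
Proof.
case: z => a b /=; have := nrm_sqr a b; have := nrm_ge0 (cpt a b).
rewrite -/(cpt a b); set r := nrm _ => r0 rE.
have [a0|a0] := leP 0 a; last by lra.
by rewrite -(@ler_pXn2r _ 2)// rE lerDl sqr_ge0.
Qed.

Lemma Cplus_neq0 z : Cplus R z -> z != 0.
Proof. by apply: contraTN => /eqP -> /=; rewrite ltxx. Qed.

Lemma CplusD z w : Cplus R z -> Cplus R w -> Cplus R (z + w).
Proof. by case: z w => a b [c d] /=; rewrite /Cplus/=; lra. Qed.

Lemma phase_exists w :
  exists c : Cplx R, nrm c <= 1 /\ c * w = Complex (nrm w) 0.
Proof.
have [->|w0] := eqVneq w 0.
  by exists 0; rewrite !nrm0 mul0r.
exists (`|w| / w); split; last by rewrite divfK// nrmE.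
rewrite nrmM nrmV /nrm normr_id -/(nrm w).
by have [->|n0] := eqVneq (nrm w) 0; rewrite ?mul0r// divff.
Qed.

Lemma is_derive_rz z l : Cplus R z -> Cplus R l ->
  is_derive l 1 (rz z) (- (z + l) ^- 2).
Proof.
move=> zp lp; have zl0 := Cplus_neq0 (CplusD zp lp).
have d1 : is_derive l 1 (fun y : Cplx R => z + y) (0 + 1).
  exact: is_deriveD.
apply: DeriveDef; first exact: derivableV.
by rewrite deriveV// (@derive_val _ _ _ _ _ _ _ d1) add0r [LHS]mulr1.
Qed.

Lemma is_derive_rz_sqr z l : Cplus R z -> Cplus R l ->
  is_derive l 1 (fun y => rz z y * rz z y) (- 2 * (z + l) ^- 3).
Proof.
move=> zp lp; have d := is_derive_rz zp lp.
apply: (is_derive_eq (is_deriveM d d)).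
by rewrite /rz /GRing.scale/= -!exprVn; ring.
Qed.

End nrm_complex.

(** * Membership and norm estimates in the algebra B *)

Section inB.
Variable R : realType.

Lemma supnorm_rhp_ge0 (f : Cplx R -> Cplx R) : (0 <= supnorm_rhp f)%E.
Proof.
apply: le_trans (ereal_sup_ubound _); last first.
  by exists (cpt 1 0) => //; rewrite /Cplus /=.
by rewrite lee_fin nrm_ge0.
Qed.

Lemma sup_derive_ge0 (f : Cplx R -> Cplx R) (a : R) : (0 <= ereal_sup
  [set (nrm ('D_1 f (cpt a b) : Cplx R))%:E | b in [set: R]])%E.
Proof.
apply: le_trans (ereal_sup_ubound _); last by exists 0.
by rewrite lee_fin nrm_ge0.
Qed.

Lemma normB0_ge0 (f : Cplx R -> Cplx R) : (0 <= normB0 f)%E.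
Proof. by apply: integral_ge0 => a _; exact: sup_derive_ge0. Qed.

Lemma normB_ge0 (f : Cplx R -> Cplx R) : 0 <= normB f.
Proof.
by rewrite addr_ge0 ?fine_ge0 ?supnorm_rhp_ge0 ?normB0_ge0.
Qed.

(** The bound on the derivative is uniform on each vertical line, hence passes to the supremum
    inside [normB0]; integrating the weight contributes [C / c]. *)
Lemma inB_le (f : Cplx R -> Cplx R) (B C c : R) : 0 < c ->
  holo_rhp f ->
  (forall z, Cplus R z -> nrm (f z) <= B) ->
  (forall a b, 0 < a -> nrm ('D_1 f (cpt a b) : Cplx R) <= C * (c + a) ^- 2) ->
  inB f /\ normB f <= B + C / c.
Proof.
move=> c0 hf fB dfC.
have sup0 := supnorm_rhp_ge0 f; have B00 := normB0_ge0 f.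
have supB : (supnorm_rhp f <= B%:E)%E.
  by apply: ge_ereal_sup => _ [z zp <-]; rewrite lee_fin; exact: fB.
(* The derivative bound at the point 1 forces the sign of [C], so that [C] can be pulled out of the
   integral. *)
have C0 : 0 <= C.
  have := le_trans (nrm_ge0 _) (dfC 1 0 ltr01).
  by rewrite pmulr_lge0// invr_gt0 exprn_gt0//; lra.
have B0C : (normB0 f <= (C / c)%:E)%E.
  apply: (@le_trans _ _
      (\int[@lebesgue_measure R]_(a in [set a : R | (0 < a)%R])
        (C%:E * ((c + a) ^- 2)%R%:E))%E).
    apply: le_integral_nonmeasurable => [a _|a /= a0].
      exact: sup_derive_ge0.
    by apply: ge_ereal_sup => _ [b _ <-]; rewrite -EFinM lee_fin; exact: dfC.
  rewrite ge0_integralZl_EFin//.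
  - by rewrite integral_inv_sqr// EFinM.
  - rewrite (_ : [set a | _] = `]0, +oo[%classic)//.
    by apply/seteqP; split=> t /=; rewrite in_itv/= andbT.
  - by move=> a _; rewrite lee_fin invr_ge0 sqr_ge0.
  - rewrite (_ : [set a | _] = `]0, +oo[%classic); last first.
      by apply/seteqP; split=> t /=; rewrite in_itv/= andbT.
    apply/measurable_EFinP; apply: open_continuous_measurable_fun => //.
    move=> x /[!inE]/=; rewrite in_itv/= andbT => /ltW.
    exact: continuous_inv_sqr.
split; first by split=> //; [exact: le_lt_trans supB (ltry _)|
  exact: le_lt_trans B0C (ltry _)].
rewrite /normB; apply: lerD.
  by rewrite -lee_fin fineK// ge0_fin_numE// (le_lt_trans supB)// ltry.
by rewrite -lee_fin fineK// ge0_fin_numE// (le_lt_trans B0C)// ltry.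
Qed.

Lemma nrm_opp2 : nrm (- 2 : Cplx R) = 2.
Proof. by rewrite nrmN /nrm normr_nat. Qed.

Lemma nrm_rz_le (z : Cplx R) (l : Cplx R) : Cplus R z -> Cplus R l ->
  nrm (rz z l) <= (complex.Re (z : R[i]) + complex.Re (l : R[i]))^-1.
Proof.
move=> zp lp; rewrite /rz nrmV.
have zl := CplusD zp lp; have := Re_le_nrm (z + l).
rewrite /Cplus/= in zl; rewrite raddfD in zl *.
by move=> h; rewrite lef_pV2 ?posrE//; exact: lt_le_trans h.
Qed.

Lemma inB_rz (z : Cplx R) : Cplus R z -> inB (rz z).
Proof.
move=> zp; have zp' := zp; rewrite /Cplus/= in zp'.
apply: (proj1 (@inB_le (rz z) (complex.Re (z : R[i]))^-1 1 _ zp' _ _ _)).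
- by move=> l lp; have [] := is_derive_rz zp lp.
- move=> l lp; apply: le_trans (nrm_rz_le zp lp) _.
  by rewrite lef_pV2 ?posrE ?addr_gt0// lerDl ltW.
- move=> a b a0; have lp : Cplus R (cpt a b) by [].
  have [_ ->] := is_derive_rz zp lp.
  rewrite nrmN -exprVn expr2 nrmM mul1r -exprVn expr2.
  by apply: ler_pM; rewrite ?nrm_ge0//; exact: nrm_rz_le.
Qed.

Lemma inB_rz_sqr (z : Cplx R) : Cplus R z -> inB (fun l => rz z l * rz z l).
Proof.
move=> zp; have zp' := zp; rewrite /Cplus/= in zp'.
set s := complex.Re (z : R[i]) in zp'.
have rs l : Cplus R l -> nrm (rz z l) <= s^-1.
  move=> lp; apply: le_trans (nrm_rz_le zp lp) _.
  by rewrite lef_pV2 ?posrE ?addr_gt0// lerDl ltW.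
(* The derivative is [-2 (z + l)^-3]: one factor is at most [s^-1], the other two at most
   [(s + Re l)^-1], whence [C = 2 / s]. *)
apply: (proj1 (@inB_le _ (s^-1 * s^-1) (2 * s^-1) _ zp' _ _ _)).
- by move=> l lp; have [] := is_derive_rz_sqr zp lp.
- by move=> l lp; rewrite nrmM; apply: ler_pM; rewrite ?nrm_ge0// rs.
- move=> a b a0; have lp : Cplus R (cpt a b) by [].
  have [_ ->] := is_derive_rz_sqr zp lp.
  rewrite nrmM nrm_opp2 -exprVn exprS nrmM expr2 nrmM -exprVn expr2 -mulrA.
  rewrite ler_pM2l//; apply: ler_pM; rewrite ?mulr_ge0 ?nrm_ge0//.
    exact: rs.
  by apply: ler_pM; rewrite ?nrm_ge0//; exact: nrm_rz_le.
Qed.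

End inB.

(** * Weighted sums of squared resolvent functions at equally spaced nodes *)

Section resolvent_grid.
Variables (R : realType) (al t : R) (c : nat -> Cplx R).
Hypothesis al0 : 0 < al.
Hypothesis cle : forall j, nrm (c j) <= al ^+ 2.

Definition node (j : nat) : Cplx R := cpt al (t + j%:R * al).

Definition grid_fun (n : nat) (l : Cplx R) : Cplx R :=
  \sum_(j < n) c j * (rz (node j) l * rz (node j) l).

Lemma Cplus_node j : Cplus R (node j).
Proof. by []. Qed.

Lemma grid_fun0 : grid_fun 0 = cst 0.
Proof. by apply/funext => l; rewrite /grid_fun big_ord0. Qed.

Lemma grid_funS n : grid_fun n.+1 =
  fun l => c n * (rz (node n) l * rz (node n) l) + grid_fun n l.
Proof. by apply/funext => l; rewrite /grid_fun big_ord_recr/= addrC. Qed.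

Lemma is_derive_grid_fun n l : Cplus R l ->
  is_derive l 1 (grid_fun n) (\sum_(j < n) c j * (- 2 * (node j + l) ^- 3)).
Proof.
move=> lp; elim: n => [|n ih].
  by rewrite grid_fun0 big_ord0; exact: is_derive_cst.
rewrite grid_funS big_ord_recr/= [X in is_derive _ _ _ X]addrC.
apply: is_deriveD => //.
exact: (is_deriveZ (c n) (is_derive_rz_sqr (Cplus_node n) lp)).
Qed.

(** With [l = a + i b], [|node j + l|^2] is [(al + a)^2 + (t + b + j al)^2], so the sum is [al]
    times the one in [grid_sum_le] with [s = al + a]. *)
Lemma sum_nrm_node_le n (l : Cplx R) : Cplus R l ->
  \sum_(j < n) al ^+ 2 * nrm ((node j + l) ^- 2) <=
  8 * al / (al + complex.Re (l : R[i])).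
Proof.
case: l => a b /= lp; have a0 : 0 < a := lp.
have := @grid_sum_le R (al + a) al (t + b) n al0 (ltac:(lra)).
rewrite -(ler_pM2l al0) mulr_sumr => h.
have -> : 8 * al / (al + a) = al * (8 / (al + a)) by ring.
apply: le_trans h; apply: ler_sum => j _.
have -> : node j + Complex a b = cpt (al + a) (t + b + j%:R * al).
  by rewrite /node /cpt; congr Complex; rewrite addrAC.
by rewrite nrmV (nrmM _ _) -expr2 nrm_sqr [al ^+ 2]expr2 mulrA.
Qed.

Lemma inB_grid_fun n : inB (grid_fun n) /\ normB (grid_fun n) <= 24.
Proof.
(* The sup norm contributes 8; the derivative, with [C = 16 al] and [c = al], contributes 16. *)
have -> : 24 = 8 + 16 * al / al :> R by rewrite mulfK ?lt0r_neq0//; lra.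
apply: inB_le => //.
- by move=> l lp; have [] := is_derive_grid_fun n lp.
- move=> l lp; apply: le_trans (ler_nrm_sum _) _.
  apply: (@le_trans _ _ (8 * al / (al + complex.Re (l : R[i])))); last first.
    have lp' := lp; rewrite /Cplus/= in lp'.
    by rewrite ler_pdivrMr ?addr_gt0// ler_pM2l// lerDl ltW.
  apply: le_trans (sum_nrm_node_le n lp).
  apply: ler_sum => j _; rewrite nrmM ler_pM ?nrm_ge0//.
  by rewrite /rz -exprVn expr2.
- move=> a b a0; have lp : Cplus R (cpt a b) by [].
  have [_ ->] := is_derive_grid_fun n lp.
  apply: le_trans (ler_nrm_sum _) _.
  have s0 : 0 < al + a by exact: addr_gt0.
  (* One factor [|node j + l|^-1] of the cube is at most [(al + a)^-1]; the remaining squares are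
     summed by [sum_nrm_node_le]. *)
  apply: (@le_trans _ _ (2 * (al + a)^-1 *
      (\sum_(j < n) al ^+ 2 * nrm ((node j + cpt a b) ^- 2)))); last first.
    apply: le_trans (ler_wpM2l _ (sum_nrm_node_le n lp)) _.
      by rewrite mulr_ge0// invr_ge0 ltW.
    by rewrite /= le_eqVlt; apply/orP; left; apply/eqP; field; exact: lt0r_neq0.
  rewrite mulr_sumr; apply: ler_sum => j _.
  rewrite 2!nrmM nrm_opp2 -exprVn exprS nrmM exprVn.
  rewrite mulrCA -[2 * _ * _]mulrA ler_pM2l//.
  rewrite mulrCA; apply: ler_pM; rewrite ?nrm_ge0 ?mulr_ge0 ?nrm_ge0//.
    exact: (nrm_rz_le (Cplus_node j) lp).
  by apply: ler_pM; rewrite ?nrm_ge0.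
Qed.

End resolvent_grid.

(** * Continuous functionals, and the calculus applied to grid sums *)

Section functional_calculus.
Variables (R : realType) (X : normedModType (Cplx R)).

(** Continuity at 0 gives a ball of radius [d] on which [|xs| < 1]; rescaling [y] to norm [d / 2]
    yields the constant [2 / d]. The radius is a positive element of [R[i]], hence the [nrm d]. *)
Lemma dual_elt_bounded (xs : X -> Cplx R) : dual_elt xs ->
  exists2 K : R, 0 <= K & forall y, nrm (xs y) <= K * nrm y.
Proof.
move=> [lin cont].
have xs0 : xs 0 = 0.
  by have := lin (- 1) 0 0; rewrite scaler0 addr0 mulN1r addNr.
have xsZ a y : xs (a *: y) = a * xs y.
  by have := lin a y 0; rewrite addr0 xs0 addr0.
have /cvgrPdist_lt/(_ _ ltr01)/nbhs_ballP[d d0 dP] := cont 0.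
have dE : nrm (d : Cplx R) = complex.Re (d : R[i]).
  by rewrite /nrm ger0_norm// ltW.
have dp : 0 < nrm (d : Cplx R).
  by rewrite dE; move: d0; rewrite /= ltcE/= => /andP[].
exists (2 / nrm (d : Cplx R)); first by rewrite divr_ge0 ?nrm_ge0.
move=> y; have [->|y0] := eqVneq y 0; first by rewrite xs0 !nrm0 mulr0.
pose a : Cplx R := d / 2 / `|y|.
have ny0 : `|y| != 0 :> Cplx R by rewrite normr_eq0.
have ny0' : nrm y != 0.
  by apply: contra_neq ny0 => h; rewrite nrmE h.
have : ball (0 : X) d (a *: y).
  rewrite -ball_normE /= sub0r normrN normrZ !normrM !normfV normr_id.
  rewrite mulfVK// normr_nat gtr0_norm// ltr_pdivrMr// ltr_pMr//.
  by rewrite ltr1n.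
move=> /dP /=; rewrite xs0 sub0r normrN xsZ => h.
have : nrm (a * xs y) <= 1.
  by move: h; rewrite ltcE /= => /andP[_ /ltW].
have -> : nrm (a * xs y) = nrm (d : Cplx R) / 2 / nrm y * nrm (xs y).
  rewrite !nrmM !nrmV; congr (_ * _ / _ * _).
    by rewrite /nrm normr_nat.
  by rewrite /nrm normr_id.
have yp : 0 < nrm y by rewrite lt_def ny0' nrm_ge0.
rewrite mulrAC ler_pdivrMr// mul1r => hh.
by rewrite mulrAC ler_pdivlMr//; lra.
Qed.

Variables (Phi : (Cplx R -> Cplx R) -> X -> X).
Hypothesis homPhi : bounded_alg_hom Phi.

Lemma alg_hom_cst0 (x : X) : Phi (cst 0) x = 0.
Proof.
have [_ Plin _ _] := homPhi.
have in0 : inB (cst 0 : Cplx R -> Cplx R).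
  have [] := @inB_grid_fun R 1 0 (cst 0) ltr01 _ 0.
    by move=> j; rewrite nrm0 sqr_ge0.
  by rewrite grid_fun0.
(* Linearity with coefficient -1 at the zero function reads [Phi 0 = - Phi 0 + Phi 0]. *)
have := Plin (-1) _ _ in0 in0.
rewrite [X in Phi X](_ : _ = cst 0); last first.
  by apply/funext => l; rewrite /= mulr0 addr0.
by move=> /(congr1 (fun F => F x)) /=; rewrite scaleN1r addNr.
Qed.

(** [Phi] is linear and multiplicative only on members of B, so each induction step supplies the
    membership of [rz], of its square and of the partial sum. *)
Lemma alg_hom_grid_fun (al t : R) (c : nat -> Cplx R) n (x : X) :
  0 < al -> (forall j, nrm (c j) <= al ^+ 2) ->
  Phi (grid_fun al t c n) x =
  \sum_(j < n) c j *: Phi (rz (node al t j)) (Phi (rz (node al t j)) x).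
Proof.
move=> al0 cle; have [_ Plin Pmul _] := homPhi.
elim: n => [|n ih]; first by rewrite grid_fun0 big_ord0 alg_hom_cst0.
have zp : Cplus R (node al t n) by exact: Cplus_node.
rewrite grid_funS (Plin _ (fun l => rz _ l * rz _ l)); last 2 first.
- exact: inB_rz_sqr.
- by case: (inB_grid_fun t al0 cle n).
by rewrite Pmul ?ih ?big_ord_recr /= 1?addrC//; exact: inB_rz.
Qed.

Lemma dual_elt_sum (xs : X -> Cplx R) n (c : nat -> Cplx R) (y : nat -> X) :
  dual_elt xs -> xs (\sum_(j < n) c j *: y j) = \sum_(j < n) c j * xs (y j).
Proof.
move=> [lin _]; elim: n => [|n ih].
  rewrite !big_ord0.
  by have := lin (- 1) 0 0; rewrite scaler0 addr0 mulN1r addNr.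
by rewrite !big_ord_recr/= addrC lin ih addrC.
Qed.

Lemma grid_resolvent_sum_le (x : X) (xs : X -> Cplx R) : dual_elt xs ->
  exists K : R, forall (al t : R) n, 0 < al ->
    al ^+ 2 * (\sum_(j < n)
      nrm (xs (Phi (rz (node al t j)) (Phi (rz (node al t j)) x)))) <= K.
Proof.
move=> dxs; have [L L0 xsL] := dual_elt_bounded dxs.
have [_ _ _ [M PM]] := homPhi.
(* [L] bounds [xs], 24 bounds the norm of the grid function in B, and [|M|] replaces the constant of
   [Phi], whose sign is not prescribed. *)
exists (L * (`|M| * 24 * nrm x)) => al t n al0.
pose w j := xs (Phi (rz (node al t j)) (Phi (rz (node al t j)) x)).
pose ph j := projT1 (cid (phase_exists (w j))).
have ph1 j : nrm (ph j) <= 1 by rewrite /ph; case: cid => ? [].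
have phw j : ph j * w j = Complex (nrm (w j)) 0.
  by rewrite /ph; case: cid => ? [].
pose c j : Cplx R := cpt (al ^+ 2) 0 * ph j.
have nal : nrm (cpt (al ^+ 2) 0 : Cplx R) = al ^+ 2.
  apply/eqP; rewrite -(@eqrXn2 _ 2)// ?nrm_ge0 ?sqr_ge0//.
  by rewrite nrm_sqr expr0n/= addr0.
have cle j : nrm (c j) <= al ^+ 2.
  by rewrite nrmM nal ler_piMr// sqr_ge0.
have [inF nF] := inB_grid_fun t al0 cle n.
have := xsL (Phi (grid_fun al t c n) x).
rewrite alg_hom_grid_fun// (dual_elt_sum _ _
  (fun j => Phi (rz (node al t j)) (Phi (rz (node al t j)) x)))//.
(* The phases rule out cancellation: [xs (Phi f x)] is itself the sum of moduli, so bounding its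
   modulus bounds that sum. *)
have -> : \sum_(j < n) c j * w j = cpt (al ^+ 2 * \sum_(j < n) nrm (w j)) 0.
  rewrite mulr_sumr; elim/big_ind2 : _ => [//|z1 a z2 b -> ->|j _].
    by rewrite /cpt; apply/eqP; rewrite eq_complex/= addr0 !eqxx.
  rewrite /c -mulrA phw /cpt; apply/eqP; rewrite eq_complex/=.
  by rewrite !mulr0 mul0r subr0 addr0 !eqxx.
rewrite -(alg_hom_grid_fun t n x al0 cle) => h.
have S0 : 0 <= al ^+ 2 * \sum_(j < n) nrm (w j).
  by rewrite mulr_ge0 ?sqr_ge0// sumr_ge0// => j _; exact: nrm_ge0.
apply: le_trans (Re_le_nrm (cpt (al ^+ 2 * \sum_(j < n) nrm (w j)) 0)) _.
apply: le_trans h _; rewrite ler_wpM2l//.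
apply: le_trans (PM _ inF x) _; rewrite ler_wpM2r ?nrm_ge0//.
apply: (@le_trans _ _ (`|M| * normB (grid_fun al t c n))).
  by rewrite ler_wpM2r ?ler_norm ?normB_ge0.
by rewrite ler_wpM2l.
Qed.
End functional_calculus.

(** * Passage from grid sums to the integral along a vertical line *)

Unset Implicit Arguments.

Theorem mainTheorem11 (R : realType) (X : completeNormedModType (Cplx R))
  (D : set X) (A : X -> X) :
  admits_B_calculus D A ->
  forall (x : X) (xs : X -> Cplx R), dual_elt xs ->
  (ereal_sup
     [set (a%:E * \int[@lebesgue_measure R]_(b in [set: R])
             (nrm (xs (resolvent D A (cpt a b)
                         (resolvent D A (cpt a b) x))))%:E)%E
     | a in [set a : R | (0 < a)%R]] < +oo)%E.
Proof.
move=> [_ _ [Phi [homPhi PhiR]]] x xs dxs.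
have [K KP] := grid_resolvent_sum_le homPhi x dxs.
apply: (@le_lt_trans _ _ K%:E); last exact: ltry.
apply: ge_ereal_sup => _ [a /= a0 <-].
rewrite muleC -lee_pdivlMr// -EFinM.
(* [K / a ^+ 2] will bound the grid sums and the factor [a] is the mesh, as in
   [integral_le_grid]. *)
have -> : K * a^-1 = K / a ^+ 2 * a by field; exact: lt0r_neq0.
apply: integral_le_grid => // [b|t n]; first exact: nrm_ge0.
rewrite ler_pdivlMr ?exprn_gt0// mulrC; apply: le_trans (KP a t n a0).
rewrite ler_pM2l ?exprn_gt0//; apply: ler_sum => j _.
by rewrite -PhiR.
Qed.
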